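(* Let $\mathbb{F}$ be a field with involution $\overline{\,\cdot\,}$, let $m,n\ge 1$, let $x,y\in\mathbb{F}^m$ and $z,w\in\mathbb{F}^n$ be column vectors with all entries nonzero, let $a,b\in\mathbb{F}\setminus\{0\}$, and let $$M=\left[\begin{array}{cc|cc}0&x^T&a&0\\ y&0&0&0\\ \hline b&0&0&z^T\\ 0&0&w&0\end{array}\right]$$ (a square matrix of order $m+n+2$). Assume $x^Ty=z^Tw=0$, that $M^\dagger$ exists and that $M$ is dual core EP invertible (equivalently, the scalars $s=x^*x$, $u=y^*y$, $t=z^*z$, $v=w^*w$, $p=b\overline{b}+z^*z$, $q=a\overline{a}+x^*x$ are all nonzero). Then the GC inverse of $M$ is $$M^{\mathrm{GC}}=\left[\begin{array}{cc|cc}0&0&b^{-1}&0\\ \overline{b}(ap)^{-1}y&0&0&0\\ \hline a^{-1}&0&0&0\\ 0&0&\overline{a}(bq)^{-1}w&0\end{array}\right].$$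
   Context: For a matrix $A=[a_{ij}]$ over a field $\mathbb{F}$ with involution $\overline{\,\cdot\,}$ (a field automorphism with $\overline{\overline{c}}=c$), $\overline{A}=[\overline{a_{ij}}]$ and $A^*=\overline{A}^{\,T}$. All $4\times4$ block matrices have rows and columns partitioned with sizes $1,m,1,n$; each $0$ is a zero block of the appropriate size. Matrices $M$ of the displayed form are the matrices whose associated digraph is a double star digraph, in canonical form. The Moore–Penrose inverse $A^\dagger$ is the unique $X$ (if it exists) with $AXA=A$, $XAX=X$, $(AX)^*=AX$, $(XA)^*=XA$. A square matrix $A$ is dual core EP invertible if there is $X$ with $A^{k+1}X=A^k$ for some nonnegative integer $k$, $X^2A=X$, $(XA)^*=XA$; such $X$ is unique, called the dual core EP inverse and denoted $A_{\mathrm{cEP}}$. When $A^\dagger$ and $A_{\mathrm{cEP}}$ exist, the generalized core (GC) inverse $A^{\mathrm{GC}}$ is the unique $X$ with $XAX=X$, $AX=A^2A_{\mathrm{cEP}}A^\dagger$, $XA=AA_{\mathrm{cEP}}$; explicitly $A^{\mathrm{GC}}=AA_{\mathrm{cEP}}A^\dagger$. *)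

(* Defs.v *)
From mathcomp Require Export all_boot all_algebra.
From mathcomp Require Export sesquilinear.

Set Implicit Arguments.
Unset Strict Implicit.
Unset Printing Implicit Defensive.

Import GRing.Theory.
Local Open Scope ring_scope.
Local Open Scope sesquilinear_scope.

Section GeneralizedInverses.
Variables (F : fieldType) (theta : involutive_rmorphism F).

Definition is_MP_inverse (m n : nat) (A : 'M[F]_(m, n)) (X : 'M[F]_(n, m)) :
    Prop :=
  [/\ A *m X *m A = A, X *m A *m X = X,
      (A *m X) ^t theta = A *m X & (X *m A) ^t theta = X *m A].

Definition MP_invertible (m n : nat) (A : 'M[F]_(m, n)) : Prop :=
  exists X, is_MP_inverse A X.

Definition is_dual_core_EP_inverse (n : nat) (A X : 'M[F]_n) : Prop :=
  [/\ exists k : nat, A ^+ k.+1 *m X = A ^+ k,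
      X *m X *m A = X & (X *m A) ^t theta = X *m A].

Definition dual_core_EP_invertible (n : nat) (A : 'M[F]_n) : Prop :=
  exists X, is_dual_core_EP_inverse A X.

(* Both auxiliary inverses are unique when they exist, so the existential
   quantifiers only name them. *)
Definition is_GC_inverse (n : nat) (A X : 'M[F]_n) : Prop :=
  exists C D : 'M[F]_n,
    [/\ is_dual_core_EP_inverse A C, is_MP_inverse A D,
        X *m A *m X = X, A *m X = A ^+ 2 *m C *m D & X *m A = A *m C].

End GeneralizedInverses.

Section DoubleStar.
Variables (F : fieldType) (m n : nat).

(* The 4 x 4 block partition has sizes 1, m, 1, n and is nested as
   (1 + m) + (1 + n). *)
Definition double_star_mx (a b : F) (x y : 'cV[F]_m) (z w : 'cV[F]_n) :
    'M[F]_((1 + m) + (1 + n)) :=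
  block_mx (block_mx 0     x^T
                     y     0)      (block_mx a%:M  0
                                             0     0)
           (block_mx b%:M  0
                     0     0)      (block_mx 0     z^T
                                             w     0).

End DoubleStar.

(* Main.v *)
Require Import Defs.
From mathcomp Require Import ring.

Set Implicit Arguments.
Unset Strict Implicit.
Unset Printing Implicit Defensive.

Import GRing.Theory.
Local Open Scope ring_scope.
Local Open Scope sesquilinear_scope.

(** Write [A^*] for the conjugate transpose, [e1], [e3] for the coordinate
columns of the two hubs, [Y], [W] for [y], [w] placed in their blocks, and
[g = (0, x^T, a, 0)], [h = (b, 0, 0, z^T)] for the rows of the matrix at the
hubs.  The matrix is then a sum of four rank-one terms,
[M = e1 g + Y e1^T + e3 h + W e3^T].

Because [x^T y = z^T w = 0], the rows [g] and [h] are exchanged by [M] up to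
scalars: [g M = a h] and [h M = b g]; moreover they span the row space of [M^2],
and they are orthogonal with [g g^* = q] and [h h^* = p].  If [C] is the dual
core EP inverse, [C M] must be the orthogonal projector onto that row space.
When [p] and [q] are nonzero this forces
[C = h^* g / (a p) + g^* h / (b q)] ([core_EP_inverse_two_cycle]); when [q = 0]
one has [M^2 g^* = 0], a fixed row of the hermitian projector [C M] would be
killed by it, and [C] cannot exist, and similarly for [p]
([core_EP_invertible_eigenrow]).

The Moore-Penrose inverse is governed by the column space [<e1, Y, e3, W>] and
the row space spanned by the two hub coordinates, [x^T] and [z^T].  Both bases
are orthogonal, so the inverse exists exactly when the nontrivial norms [u], [v]
and [s], [t] are nonzero: it is then explicit ([double_star_MP]), while an
isotropic vector of the column space or of the row space would be orthogonal to
the whole space ([MP_invertible_image_eq0], [MP_invertible_row_eq0]).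

Finally, the three defining equations force the generalized core inverse to be
[M C D] with [C], [D] the two other inverses, which gives uniqueness
([GC_inverse_unique]).  Conversely a matrix [X] is that product as soon as
[X M = M C] and [X] is unchanged by the projector [M D] on its right
([GC_inverse_intro]); for the displayed matrix the second condition is
immediate, since its nonzero columns are those of the hubs and [M D] fixes
[e1^T] and [e3^T]. *)

(** * Conjugate transposes and norms *)

Section GeneralizedInverses.
Variables (F : fieldType) (theta : involutive_rmorphism F).

Lemma ctr_mul (m n p : nat) (A : 'M[F]_(m, n)) (B : 'M[F]_(n, p)) :
  (A *m B) ^t theta = B ^t theta *m A ^t theta.
Proof. by rewrite trmx_mul map_mxM. Qed.

Lemma ctrK (m n : nat) (A : 'M[F]_(m, n)) : A ^t theta ^t theta = A.
Proof. by apply/matrixP => i j; rewrite !mxE rmorphK. Qed.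

Lemma conj_tr_conj (k : nat) (e : 'cV[F]_k) : (map_mx theta e) ^t theta = e^T.
Proof. by apply/matrixP => i j; rewrite !mxE rmorphK. Qed.

Lemma ctrZ (m n : nat) (c : F) (A : 'M[F]_(m, n)) :
  (c *: A) ^t theta = theta c *: A ^t theta.
Proof. by rewrite linearZ /= map_mxZ. Qed.

Lemma ctrZV (k l : nat) (c : F) (A : 'M[F]_(k, l)) :
  theta c = c -> (c^-1 *: A) ^t theta = c^-1 *: A ^t theta.
Proof. by move=> c_real; rewrite ctrZ fmorphV; congr (_^-1 *: _). Qed.

Lemma mul_tr_conj (k : nat) (e : 'cV[F]_k) (c : F) :
  e ^t theta *m e = c%:M -> e^T *m map_mx theta e = c%:M.
Proof.
move=> ec; rewrite -[c%:M]tr_scalar_mx -ec trmx_mul.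
by congr (_ *m _); apply/matrixP => i j; rewrite !mxE.
Qed.

Lemma norm_real (k : nat) (e : 'cV[F]_k) (c : F) :
  e ^t theta *m e = c%:M -> theta c = c.
Proof.
move=> ec; have : (e ^t theta *m e) ^t theta = e ^t theta *m e.
  by rewrite ctr_mul ctrK.
by rewrite ec tr_scalar_mx map_scalar_mx => /matrixP /(_ 0 0); rewrite !mxE.
Qed.

(** The off-diagonal entries of the two Moore-Penrose projectors have this
shape. *)
Lemma scale_norm_cancel (k l : nat) (c d e : F) (A : 'M[F]_(k, l)) :
  d != 0 -> e != 0 ->
  c *: (d^-1 *: A) + (- (c / (e * d)) * e) *: A = 0.
Proof.
by move=> d0 e0; rewrite scalerA -scalerDl [X in X *: _](_ : _ = 0) ?scale0r //;
  field; rewrite d0.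
Qed.

Lemma scale_sandwich (k l : nat) (c d : F) (A : 'M[F]_(k, l)) :
  d != 0 -> d^-1 *: (c *: (d *: A)) = c *: A.
Proof. by move=> d0; rewrite !scalerA mulrCA mulVf // mulr1. Qed.

Lemma exists_dual (k : nat) (c : F) (e : 'cV[F]_k) :
  e != 0 -> exists d : 'cV[F]_k, e^T *m d = c%:M.
Proof.
move=> /cV0Pn [i ei0]; exists ((c / e i 0) *: delta_mx i 0).
rewrite -scalemxAr -colE [col _ _]mx11_scalar scale_scalar_mx !mxE.
by rewrite mulfVK.
Qed.

(** * Moore-Penrose inverses *)

Lemma MP_inverse_unique (m n : nat) (A : 'M[F]_(m, n)) (D D' : 'M[F]_(n, m)) :
  is_MP_inverse theta A D -> is_MP_inverse theta A D' -> D = D'.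
Proof.
move=> [ADA DAD hAD hDA] [ADA' DAD' hAD' hDA'].
have eAD : A *m D = A *m D'.
  by rewrite -hAD -{1}ADA' -mulmxA ctr_mul hAD hAD' mulmxA ADA.
have eDA : D *m A = D' *m A.
  by rewrite -hDA -{1}ADA' -mulmxA mulmxA ctr_mul hDA hDA' -mulmxA
    [A *m (D *m A)]mulmxA ADA.
by rewrite -DAD eDA -mulmxA eAD mulmxA DAD'.
Qed.

(** Since [A D] is hermitian and fixes the column space of [A], being orthogonal
to the columns of [A] and lying in their span forces a vector to vanish, even
though the hermitian form may have isotropic vectors. *)
Lemma MP_invertible_image_eq0 (m n p : nat)
    (A : 'M[F]_(m, n)) (B : 'M[F]_(n, p)) :
  MP_invertible theta A -> (A *m B) ^t theta *m A = 0 -> A *m B = 0.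
Proof.
move=> [D [ADA _ hAD _]] BAA0.
suff ctr0 : (A *m B) ^t theta = 0 by rewrite -[LHS]ctrK ctr0 trmx0 map_mx0.
by rewrite -{1}ADA -[A *m D *m A *m B]mulmxA ctr_mul hAD mulmxA BAA0 mul0mx.
Qed.

(** The same argument on rows, with the hermitian idempotent [D A]. *)
Lemma MP_invertible_row_eq0 (m n p : nat)
    (A : 'M[F]_(m, n)) (B : 'M[F]_(p, m)) :
  MP_invertible theta A -> A *m (B *m A) ^t theta = 0 -> B *m A = 0.
Proof.
move=> [D [ADA _ _ hDA]] ABA0.
suff ctr0 : (B *m A) ^t theta = 0 by rewrite -[LHS]ctrK ctr0 trmx0 map_mx0.
by rewrite -{1}ADA -[A *m D *m A]mulmxA mulmxA ctr_mul hDA -mulmxA ABA0 mulmx0.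
Qed.

(** * Dual core EP and generalized core inverses *)

Section Square.
Variable n : nat.
Implicit Types A C D X : 'M[F]_n.

Lemma core_EP_iter A C k : is_dual_core_EP_inverse theta A C ->
  C ^+ k.+1 * A ^+ k = C.
Proof.
move=> [_ CCA _]; elim: k => [|k IH]; first by rewrite expr1 expr0 mulr1.
rewrite exprS (exprSr A) mulrA -(mulrA C) IH; exact: CCA.
Qed.

(** Any two candidates satisfy [C A C' = C], whatever their indices: expand [C]
as [C ^+ k.+1 * A ^+ k] with the index [k] of [C'].  Hence the two hermitian
idempotents [C A] and [C' A] absorb each other and coincide. *)
Lemma core_EP_inverse_unique A C C' :
  is_dual_core_EP_inverse theta A C -> is_dual_core_EP_inverse theta A C' ->
  C = C'.
Proof.
have absorb X Y : is_dual_core_EP_inverse theta A X ->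
    is_dual_core_EP_inverse theta A Y -> X *m A *m Y = X.
  move=> hX [[k hk] _ _]; rewrite -(core_EP_iter k hX) !mulmxE -!mulrA.
  by rewrite (mulrA (A ^+ k)) -exprSr [A ^+ _ * Y]hk.
move=> hC hC'; have [_ _ herm] := hC; have [_ _ herm'] := hC'.
have eCA : C *m A = C' *m A.
  by rewrite -herm -{1}(absorb C C' hC hC') -mulmxA ctr_mul herm herm' mulmxA
    (absorb C' C hC' hC).
by rewrite -(absorb C C' hC hC') eCA (absorb C' C').
Qed.

Lemma core_EP_outer A C : is_dual_core_EP_inverse theta A C -> C *m A *m C = C.
Proof.
move=> hC; have [[k hk] _ _] := hC.
by rewrite -{1}(core_EP_iter k hC) !mulmxE -!mulrA
  (mulrA (A ^+ k)) -exprSr [A ^+ _ * C]hk core_EP_iter.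
Qed.

(** Every solution equals [A C D]: [Y = (Y A) Y = Y (A ^+ 2 C D)] and
[Y A = A C] give [Y = A C A C D], which collapses since [C A C = C]. *)
Lemma GC_inverse_unique A X X' :
  is_GC_inverse theta A X -> is_GC_inverse theta A X' -> X = X'.
Proof.
have closed_form Y : is_GC_inverse theta A Y -> exists C D,
    [/\ is_dual_core_EP_inverse theta A C, is_MP_inverse theta A D &
        Y = A *m C *m D].
  move=> [C [D [hC hD YAY AY YA]]]; exists C, D; split=> //.
  rewrite -YAY -mulmxA AY expr2 -mulmxE !mulmxA YA.
  by rewrite -[A *m C *m A]mulmxA -[_ *m _ *m C]mulmxA (core_EP_outer hC).
move=> /closed_form [C [D [hC hD ->]]] /closed_form [C' [D' [hC' hD' ->]]].
by rewrite (core_EP_inverse_unique hC hC') (MP_inverse_unique hD hD').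
Qed.

(** The two assumptions avoid computing the triple products: together they say
that [X = A C D]. *)
Lemma GC_inverse_intro A C D X :
  is_dual_core_EP_inverse theta A C -> is_MP_inverse theta A D ->
  X *m A = A *m C -> X *m (A *m D) = X -> is_GC_inverse theta A X.
Proof.
move=> hC hD XA XAD.
have {XAD} eX : X = A *m C *m D by rewrite -XA -mulmxA.
exists C, D; split=> //.
- by rewrite XA eX !mulmxA -[A *m C *m A]mulmxA -[_ *m _ *m C]mulmxA
    (core_EP_outer hC).
- by rewrite eX expr2 -mulmxE !mulmxA.
Qed.

(** The row [g] lies in the row space of every power of [A], hence is fixed by
[C A]; but [C A] is hermitian and equals [C C A A], so it also kills [g^*]. *)
Lemma core_EP_invertible_eigenrow A (c : F) (g : 'rV[F]_n) :
  dual_core_EP_invertible theta A -> c != 0 -> g *m A *m A = c *: g ->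
  A *m (A *m g ^t theta) = 0 -> g = 0.
Proof.
move=> [C [[k hk] CCA herm]] c0 gAA AAg.
(* Even powers of [A] act on [g] by scalars; [A ^+ (2 * k.+1)] absorbs [C A]. *)
have gpow j : g *m A ^+ (j * 2) = c ^+ j *: g.
  elim: j => [|j IH]; first by rewrite mul0n !expr0 mulmx1 scale1r.
  by rewrite mulSn exprD expr2 -!mulmxE !mulmxA gAA -scalemxAl IH exprS scalerA.
have gCA : g *m (C *m A) = g.
  apply: (@scalerI _ _ (c ^+ k.+1)); first by rewrite expf_neq0.
  rewrite scalemxAl -gpow muln2 -addnn exprD -!mulmxE -!mulmxA.
  by rewrite [_ *m (C *m A)]mulmxA hk mulmxE -exprSr.
have ctr0 : g ^t theta = 0.
  by rewrite -gCA ctr_mul herm -CCA -!mulmxA AAg !mulmx0.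
by rewrite -[LHS]ctrK ctr0 trmx0 map_mx0.
Qed.

(** With [g], [h] orthogonal and spanning the row space of [A ^+ 2], the
coefficients are chosen so that [C A = h^* h / p + g^* g / q], the orthogonal
projector onto that span. *)
Lemma core_EP_inverse_two_cycle A (g h : 'rV[F]_n) (al be : 'cV[F]_n)
    (c d p q : F) :
  c != 0 -> d != 0 -> p != 0 -> q != 0 ->
  g *m A = c *: h -> h *m A = d *: g ->
  g *m h ^t theta = 0 -> g *m g ^t theta = q%:M -> h *m h ^t theta = p%:M ->
  A *m A = al *m g + be *m h ->
  is_dual_core_EP_inverse theta A
    ((c * p)^-1 *: (h ^t theta *m g) + (d * q)^-1 *: (g ^t theta *m h)).
Proof.
move=> c0 d0 p0 q0 gA hA gh gg hh AA.
set C := _ + _.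
have hg : h *m g ^t theta = 0.
  by rewrite -[LHS]ctrK ctr_mul ctrK gh trmx0 map_mx0.
have CA : C *m A = p^-1 *: (h ^t theta *m h) + q^-1 *: (g ^t theta *m g).
  rewrite mulmxDl -!scalemxAl -!mulmxA gA hA -!scalemxAr !scalerA.
  by rewrite !invfM [c^-1 * _ * c]mulrAC [d^-1 * _ * d]mulrAC !mulVf // !mul1r.
have gC : g *m C = d^-1 *: h.
  rewrite mulmxDr -!scalemxAr !mulmxA gh gg mul0mx scaler0 add0r.
  by rewrite mul_scalar_mx scalerA invfM mulfVK.
have hC : h *m C = c^-1 *: g.
  rewrite mulmxDr -!scalemxAr !mulmxA hg hh mul0mx scaler0 addr0.
  by rewrite mul_scalar_mx scalerA invfM mulfVK.
have gCA : g *m (C *m A) = g.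
  by rewrite mulmxA gC -scalemxAl hA scalerA mulVf ?scale1r.
have hCA : h *m (C *m A) = h.
  by rewrite mulmxA hC -scalemxAl gA scalerA mulVf ?scale1r.
have hp : theta p = p by apply: (@norm_real _ (h ^t theta)); rewrite ctrK.
have hq : theta q = q by apply: (@norm_real _ (g ^t theta)); rewrite ctrK.
split.
(* From exponent 2 on, the powers of [A] only involve the rows [g] and [h]. *)
- exists 2%N; rewrite exprSr expr2 -!mulmxE AA -[RHS]AA [in RHS]AA.
  rewrite !mulmxDl -![_ *m _ *m A]mulmxA gA hA -!scalemxAr -!scalemxAl -!mulmxA.
  by rewrite gC hC -!scalemxAr !scalerA !mulfV // !scale1r.
- by rewrite -mulmxA {1}/C mulmxDl -!scalemxAl -!mulmxA gCA hCA.
- by rewrite CA linearD /= map_mxD !ctrZV // !ctr_mul !ctrK.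
Qed.

End Square.

End GeneralizedInverses.

(** * The rows of a double star matrix at its hubs *)

Section DoubleStar.
Variables (F : fieldType) (theta : involutive_rmorphism F) (m n : nat).
Variables (a b : F) (x y : 'cV[F]_m) (z w : 'cV[F]_n).
Hypotheses (a0 : a != 0) (b0 : b != 0).
Hypotheses (hxy : x^T *m y = 0) (hzw : z^T *m w = 0).

(* The norms are kept as abstract scalars so that rewriting with the block
   products does not reach inside them. *)
Variables s u t v : F.
Hypotheses (hs : x ^t theta *m x = s%:M) (hu : y ^t theta *m y = u%:M).
Hypotheses (ht : z ^t theta *m z = t%:M) (hv : w ^t theta *m w = v%:M).

Local Notation M := (double_star_mx a b x y z w).
Local Notation p := (b * theta b + t).
Local Notation q := (a * theta a + s).

Local Notation blockE :=
  (mulmx_block, mul_row_block, mul_block_col, mul_row_col,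
   mulmx0, mul0mx, mulmx1, mul1mx, mul_mx_scalar, mul_scalar_mx, scaler0,
   add_block_mx, add_row_mx, add_col_mx, addr0, add0r)
  (only parsing).

Local Notation ctr_blockE :=
  (tr_block_mx, tr_row_mx, tr_col_mx, map_block_mx, map_row_mx, map_col_mx,
   trmx0, map_mx0, trmx1, map_mx1, tr_scalar_mx, map_scalar_mx, trmxK)
  (only parsing).

Definition hub_row1 : 'rV[F]_((1 + m) + (1 + n)) :=
  row_mx (row_mx 0 x^T) (row_mx a%:M 0).

Definition hub_row2 : 'rV[F]_((1 + m) + (1 + n)) :=
  row_mx (row_mx b%:M 0) (row_mx 0 z^T).

Local Notation g := hub_row1.
Local Notation h := hub_row2.

Lemma ctr_hub_row1 :
  g ^t theta = col_mx (col_mx 0 (map_mx theta x)) (col_mx (theta a)%:M 0).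
Proof. by rewrite /g !ctr_blockE. Qed.

Lemma ctr_hub_row2 :
  h ^t theta = col_mx (col_mx (theta b)%:M 0) (col_mx 0 (map_mx theta z)).
Proof. by rewrite /h !ctr_blockE. Qed.

Lemma hub_row1_mul : g *m M = a *: h.
Proof.
rewrite /g /h /double_star_mx !blockE hxy !scale_row_mx !blockE.
by rewrite !scale_scalar_mx mulrC.
Qed.

Lemma hub_row2_mul : h *m M = b *: g.
Proof.
rewrite /g /h /double_star_mx !blockE hzw !scale_row_mx !blockE.
by rewrite !scale_scalar_mx mulrC.
Qed.

Lemma hub_rows_orthogonal : g *m h ^t theta = 0.
Proof. by rewrite ctr_hub_row2 !blockE. Qed.

Lemma norm_hub_row1 : g *m g ^t theta = q%:M.
Proof.
rewrite ctr_hub_row1 !blockE (mul_tr_conj hs) scale_scalar_mx addrC.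
by rewrite [RHS]raddfD /= mulrC.
Qed.

Lemma norm_hub_row2 : h *m h ^t theta = p%:M.
Proof.
rewrite ctr_hub_row2 !blockE (mul_tr_conj ht) scale_scalar_mx [RHS]raddfD /=.
by rewrite mulrC.
Qed.

Lemma sqr_double_star :
  M *m M = col_mx (col_mx 0 y) (col_mx b%:M 0) *m g
           + col_mx (col_mx a%:M 0) (col_mx 0 w) *m h.
Proof.
by rewrite /double_star_mx !mul_col_row !blockE hxy hzw !blockE.
Qed.

(** * The Moore-Penrose inverse of a double star matrix *)

(** As a map on columns, it sends [e1], [e3] to the conjugates of [x], [z]
divided by their norms, and [Y], [W] to [e1 - (b / t) conj z] and
[e3 - (a / s) conj x].  These are preimages under [M] of [e1], [e3], [Y], [W]
lying in the column space of [M^*]. *)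
Definition MP_double_star : 'M[F]_((1 + m) + (1 + n)) :=
  block_mx (block_mx 0                          (u^-1 *: y ^t theta)
                     (s^-1 *: map_mx theta x)   0)
           (block_mx 0                          0
                     0 (- (a / (s * v)) *: (map_mx theta x *m w ^t theta)))
           (block_mx 0                          0
                     0 (- (b / (t * u)) *: (map_mx theta z *m y ^t theta)))
           (block_mx 0                          (v^-1 *: w ^t theta)
                     (t^-1 *: map_mx theta z)   0).

Lemma mul_double_star_MP : s != 0 -> u != 0 -> t != 0 -> v != 0 ->
  M *m MP_double_star =
  block_mx (block_mx 1%:M 0 0 (u^-1 *: (y *m y ^t theta))) 0
           0 (block_mx 1%:M 0 0 (v^-1 *: (w *m w ^t theta))).
Proof.
move=> s0 u0 t0 v0.
rewrite /double_star_mx /MP_double_star !blockE -!scalemxAr !mulmxA.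
rewrite (mul_tr_conj hs) (mul_tr_conj ht) !mul_scalar_mx.
rewrite !(scalerA (- _)) [_ + a *: _]addrC !scale_norm_cancel //.
by rewrite !scale_scalar_mx !mulVf // !block_mx0.
Qed.

Lemma mul_MP_double_star : s != 0 -> u != 0 -> t != 0 -> v != 0 ->
  MP_double_star *m M =
  block_mx (block_mx 1%:M 0 0 (s^-1 *: (map_mx theta x *m x^T))) 0
           0 (block_mx 1%:M 0 0 (t^-1 *: (map_mx theta z *m z^T))).
Proof.
move=> s0 u0 t0 v0.
rewrite /double_star_mx /MP_double_star !blockE -!scalemxAl -!mulmxA.
rewrite hu hv !mul_mx_scalar !(scalerA (- _)) [_ + b *: _]addrC.
rewrite [s * v]mulrC [t * u]mulrC !scale_norm_cancel //.
by rewrite !scale_scalar_mx !mulVf // !block_mx0.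
Qed.

Lemma double_star_MP : s != 0 -> u != 0 -> t != 0 -> v != 0 ->
  is_MP_inverse theta M MP_double_star.
Proof.
move=> s0 u0 t0 v0; split.
- rewrite mul_double_star_MP // /double_star_mx !blockE -!scalemxAl -!mulmxA.
  by rewrite hu hv !mul_mx_scalar !scalerA !mulVf // !scale1r.
- rewrite mul_MP_double_star // /MP_double_star !blockE -!scalemxAl -!scalemxAr.
  rewrite -!mulmxA ![_^T *m (_ *m _)]mulmxA (mul_tr_conj hs) (mul_tr_conj ht).
  by rewrite !mul_scalar_mx !mul_mx_scalar -!scalemxAr !scale_sandwich.
- rewrite mul_double_star_MP // !ctr_blockE.
  by rewrite (ctrZV _ (norm_real hu)) (ctrZV _ (norm_real hv)) !ctr_mul !ctrK.
- rewrite mul_MP_double_star // !ctr_blockE.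
  rewrite (ctrZV _ (norm_real hs)) (ctrZV _ (norm_real ht)).
  by rewrite !ctr_mul !conj_tr_conj !trmxK.
Qed.

(** If [u = 0] then [Y] is orthogonal to the column space of [M].  It lies in
that space: [M e1 = Y + b e3], and a vector [k] in the last block with
[z^T k = - b] is sent by [M] to [- b e3].  The case [v = 0] is symmetric. *)
Lemma double_star_MP_norms_col : y != 0 -> w != 0 -> x != 0 -> z != 0 ->
  MP_invertible theta M -> u != 0 /\ v != 0.
Proof.
move=> y0 w0 x0 z0 hM; split; [apply: contra_neq y0 | apply: contra_neq w0].
  move=> u0; have [k zk] := exists_dual (- b) z0.
  have Mk : M *m col_mx (col_mx 1%:M 0) (col_mx 0 k) = col_mx (col_mx 0 y) 0.
    rewrite /double_star_mx !blockE zk.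
    by rewrite -raddfD /= subrr raddf0 col_mx0.
  have := MP_invertible_image_eq0 hM (B := col_mx (col_mx 1%:M 0) (col_mx 0 k)).
  rewrite Mk !ctr_blockE /double_star_mx !blockE hu u0 raddf0 !row_mx0.
  by move=> /(_ erefl) /eqP; rewrite !col_mx_eq0 => /andP [/andP [_ /eqP]].
move=> v0; have [k xk] := exists_dual (- a) x0.
have Mk : M *m col_mx (col_mx 0 k) (col_mx 1%:M 0) = col_mx 0 (col_mx 0 w).
  rewrite /double_star_mx !blockE xk.
  by rewrite -raddfD /= addNr raddf0 col_mx0.
have := MP_invertible_image_eq0 hM (B := col_mx (col_mx 0 k) (col_mx 1%:M 0)).
rewrite Mk !ctr_blockE /double_star_mx !blockE hv v0 raddf0 !row_mx0.
by move=> /(_ erefl) /eqP; rewrite !col_mx_eq0 => /andP [_ /andP [_ /eqP]].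
Qed.

(** Row version: [x^T] is obtained from [g] by cancelling its entry [a] with a
combination [k] of the rows of the block [w]. *)
Lemma double_star_MP_norms_row : y != 0 -> w != 0 -> x != 0 -> z != 0 ->
  MP_invertible theta M -> s != 0 /\ t != 0.
Proof.
move=> y0 w0 x0 z0 hM; split; [apply: contra_neq x0 | apply: contra_neq z0].
  move=> s0; have [k wk] := exists_dual (- a) w0.
  pose B : 'rV[F]_((1 + m) + (1 + n)) := row_mx (row_mx 1%:M 0) (row_mx 0 k^T).
  have BM : B *m M = row_mx (row_mx 0 x^T) 0.
    rewrite /B /double_star_mx !blockE -[k^T *m w]trmxK trmx_mul trmxK wk.
    by rewrite tr_scalar_mx -raddfD /= subrr raddf0 row_mx0.
  have := MP_invertible_row_eq0 hM (B := B).
  rewrite BM !ctr_blockE /double_star_mx !blockE (mul_tr_conj hs) s0 raddf0.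
  rewrite !col_mx0 => /(_ erefl) /eqP; rewrite !row_mx_eq0 trmx_eq0.
  by move=> /andP [/andP [_ /eqP]].
move=> t0; have [k yk] := exists_dual (- b) y0.
pose B : 'rV[F]_((1 + m) + (1 + n)) := row_mx (row_mx 0 k^T) (row_mx 1%:M 0).
have BM : B *m M = row_mx 0 (row_mx 0 z^T).
  rewrite /B /double_star_mx !blockE -[k^T *m y]trmxK trmx_mul trmxK yk.
  by rewrite tr_scalar_mx -raddfD /= addNr raddf0 row_mx0.
have := MP_invertible_row_eq0 hM (B := B).
rewrite BM !ctr_blockE /double_star_mx !blockE (mul_tr_conj ht) t0 raddf0.
rewrite !col_mx0 => /(_ erefl) /eqP; rewrite !row_mx_eq0 trmx_eq0.
by move=> /andP [_ /andP [_ /eqP]].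
Qed.

(** * The dual core EP inverse of a double star matrix *)

Lemma double_star_core_EP : p != 0 -> q != 0 ->
  is_dual_core_EP_inverse theta M
    ((a * p)^-1 *: (h ^t theta *m g) + (b * q)^-1 *: (g ^t theta *m h)).
Proof.
move=> p0 q0; apply: core_EP_inverse_two_cycle sqr_double_star => //.
- exact: hub_row1_mul.
- exact: hub_row2_mul.
- exact: hub_rows_orthogonal.
- exact: norm_hub_row1.
- exact: norm_hub_row2.
Qed.

Lemma hub_row1_neq0 : g != 0.
Proof.
apply: contra_neq a0 => /eqP; rewrite /g !row_mx_eq0 => /andP [_ /andP [/eqP]].
by move=> /matrixP /(_ 0 0); rewrite !mxE.
Qed.

Lemma hub_row2_neq0 : h != 0.
Proof.
apply: contra_neq b0 => /eqP; rewrite /h !row_mx_eq0 => /andP [/andP [/eqP]].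
by move=> /matrixP /(_ 0 0); rewrite !mxE.
Qed.

Lemma mul_ctr_hub_row1 :
  M *m g ^t theta = col_mx (col_mx q%:M 0) (col_mx 0 (theta a *: w)).
Proof.
rewrite ctr_hub_row1 /double_star_mx !blockE (mul_tr_conj hs) scale_scalar_mx.
by rewrite mulrC -raddfD /= addrC.
Qed.

Lemma mul_ctr_hub_row2 :
  M *m h ^t theta = col_mx (col_mx 0 (theta b *: y)) (col_mx p%:M 0).
Proof.
rewrite ctr_hub_row2 /double_star_mx !blockE (mul_tr_conj ht) scale_scalar_mx.
by rewrite mulrC -raddfD /=.
Qed.

(** If [p = 0] then [M h^*] is a multiple of [Y], which [M] kills; if [q = 0]
then [M g^*] is a multiple of [W], also killed.  In both cases [M^2]
kills the conjugate of a row that it rescales by [a b]. *)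
Lemma double_star_core_EP_norms :
  dual_core_EP_invertible theta M -> p != 0 /\ q != 0.
Proof.
move=> hM; have ab0 : a * b != 0 by rewrite mulf_neq0.
split; [apply: contra_neq hub_row2_neq0 | apply: contra_neq hub_row1_neq0].
- move=> p0; apply: (core_EP_invertible_eigenrow hM ab0).
    by rewrite hub_row2_mul -scalemxAl hub_row1_mul scalerA mulrC.
  rewrite mul_ctr_hub_row2 p0 /double_star_mx !blockE -!scalemxAr hxy.
  by rewrite !scale0r !blockE !col_mx0.
- move=> q0; apply: (core_EP_invertible_eigenrow hM ab0).
    by rewrite hub_row1_mul -scalemxAl hub_row2_mul scalerA mulrC.
  rewrite mul_ctr_hub_row1 q0 /double_star_mx !blockE -!scalemxAr hzw.
  by rewrite !scale0r !blockE !col_mx0.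
Qed.

(** * The generalized core inverse of a double star matrix *)

Definition GC_double_star : 'M[F]_((1 + m) + (1 + n)) :=
  block_mx (block_mx 0                              0
                     ((theta b * (a * p)^-1) *: y)  0)
           (block_mx (b^-1)%:M                      0
                     0                              0)
           (block_mx (a^-1)%:M                      0
                     0                              0)
           (block_mx 0                              0
                     ((theta a * (b * q)^-1) *: w)  0).

Lemma GC_double_starP :
  s != 0 -> u != 0 -> t != 0 -> v != 0 -> p != 0 -> q != 0 ->
  is_GC_inverse theta M GC_double_star.
Proof.
move=> s0 u0 t0 v0 p0 q0.
have hC := double_star_core_EP p0 q0; have hD := double_star_MP s0 u0 t0 v0.
apply: GC_inverse_intro hC hD _ _.
  rewrite mulmxDr -!scalemxAr !mulmxA mul_ctr_hub_row1 mul_ctr_hub_row2.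
  rewrite /GC_double_star /double_star_mx !mul_col_row !blockE.
  rewrite !scale_block_mx !blockE -!scalemxAl !scalerA !scale_scalar_mx.
  (* Both sides are now block matrices of matching shape whose scalars differ
     only by cancellations. *)
  have E1 (c d : F) : c != 0 -> d != 0 -> (c * d)^-1 * c * d = c / c.
    by move=> c0 d0; field; rewrite c0.
  have E2 (c d e : F) : (c * d)^-1 * c * e = c * (e / (c * d)).
    by rewrite -mulrA mulrC mulrA.
  have E3 (c d : F) : d != 0 -> (c * d)^-1 * d = c^-1.
    by move=> d0; rewrite invfM mulfVK.
  by rewrite !E1 // !E2 !E3 // ![_^-1 * theta _]mulrC.
by rewrite mul_double_star_MP // /GC_double_star !blockE.
Qed.

End DoubleStar.

Theorem lemma6p3 (F : fieldType) (theta : involutive_rmorphism F) (m n : nat)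
  (hm : (1 <= m)%N) (hn : (1 <= n)%N)
  (x y : 'cV[F]_m) (z w : 'cV[F]_n) (a b : F)
  (hx : forall i, x i 0 != 0) (hy : forall i, y i 0 != 0)
  (hz : forall j, z j 0 != 0) (hw : forall j, w j 0 != 0)
  (ha : a != 0) (hb : b != 0)
  (hxy : x^T *m y = 0) (hzw : z^T *m w = 0) :
  let M := double_star_mx a b x y z w in
  let s := (x ^t theta *m x) 0 0 in
  let u := (y ^t theta *m y) 0 0 in
  let t := (z ^t theta *m z) 0 0 in
  let v := (w ^t theta *m w) 0 0 in
  let p := b * theta b + t in
  let q := a * theta a + s in
  (MP_invertible theta M /\ dual_core_EP_invertible theta M <->
     [&& s != 0, u != 0, t != 0, v != 0, p != 0 & q != 0])
  /\
  (MP_invertible theta M -> dual_core_EP_invertible theta M ->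
   unique (is_GC_inverse theta M)
     (block_mx
        (block_mx 0                              0
                  ((theta b * (a * p)^-1) *: y)  0)
        (block_mx (b^-1)%:M                      0
                  0                              0)
        (block_mx (a^-1)%:M                      0
                  0                              0)
        (block_mx 0                              0
                  ((theta a * (b * q)^-1) *: w)  0))).
Proof.
move=> M s u t v p q.
have hs := mx11_scalar (x ^t theta *m x).
have hu := mx11_scalar (y ^t theta *m y).
have ht := mx11_scalar (z ^t theta *m z).
have hv := mx11_scalar (w ^t theta *m w).
have x0 : x != 0 by apply/cV0Pn; exists (Ordinal hm).
have y0 : y != 0 by apply/cV0Pn; exists (Ordinal hm).
have z0 : z != 0 by apply/cV0Pn; exists (Ordinal hn).
have w0 : w != 0 by apply/cV0Pn; exists (Ordinal hn).
have nz : MP_invertible theta M /\ dual_core_EP_invertible theta M ->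
    [/\ s != 0, u != 0, t != 0, v != 0 & p != 0 /\ q != 0].
  move=> [hMP hEP].
  have [u0 v0] := double_star_MP_norms_col hu hv y0 w0 x0 z0 hMP.
  have [s0 t0] := double_star_MP_norms_row hs ht y0 w0 x0 z0 hMP.
  by have := double_star_core_EP_norms ha hb hxy hzw hs ht hEP.
split.
- split=> [/nz [-> -> -> -> [-> ->]] // |].
  move=> /and5P [s0 u0 t0 v0 /andP [p0 q0]]; split.
    by eexists; apply: double_star_MP hs hu ht hv s0 u0 t0 v0.
  have hC := double_star_core_EP ha hb hxy hzw hs ht p0 q0.
  exact: ex_intro hC.
- move=> hMP hEP; have [s0 u0 t0 v0 [p0 q0]] := nz (conj hMP hEP).
  have GC := GC_double_starP ha hb hxy hzw hs hu ht hv s0 u0 t0 v0 p0 q0.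
  by split=> // X; apply: GC_inverse_unique GC.
Qed.
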